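(* Let $A=\mathbb{R}[x_1,\dots,x_k]/\mathfrak{j}$ be a Weil algebra with width $\mathrm{w}(A)=k$. Suppose that there exist real numbers $\tau_1,\dots,\tau_k$, either all in $\mathbb{R}\setminus[-1,1]$ or all in $(-1,1)\setminus\{0\}$, such that $H_{\tau_1,\dots,\tau_k}(\mathfrak{j})\subseteq\mathfrak{j}$, where $H_{\tau_1,\dots,\tau_k}\colon\mathbb{R}[x_1,\dots,x_k]\to\mathbb{R}[x_1,\dots,x_k]$ is the $\mathbb{R}$-algebra homomorphism given by $x_i\mapsto\tau_i x_i$ for $i=1,\dots,k$. Then the subalgebra $SA$ of fixed points of $A$ is trivial, i.e. $SA=\mathbb{R}$.
   Context: A Weil algebra is a local commutative $\mathbb{R}$-algebra $A$ with identity whose nilradical (ideal of nilpotent elements) $\mathfrak{n}_A$ has finite dimension as a real vector space and satisfies $A/\mathfrak{n}_A=\mathbb{R}$. Its order $\mathrm{ord}(A)$ is the minimal integer $r$ with $\mathfrak{n}_A^{r+1}=0$, and its width is $\mathrm{w}(A)=\dim_{\mathbb{R}}(\mathfrak{n}_A/\mathfrak{n}_A^2)$. A Weil algebra of order $r$ and width $k$ is expressed as $A=\mathbb{R}[x_1,\dots,x_k]/\mathfrak{j}$ with $\mathfrak{j}=\mathfrak{i}+\mathfrak{m}^{r+1}$, where $\mathfrak{m}=\langle x_1,\dots,x_k\rangle$ is the ideal of $\mathbb{R}[x_1,\dots,x_k]$ generated by the indeterminates and $\mathfrak{i}\subseteq\mathfrak{m}^2$ is an ideal; in particular $\mathfrak{m}^{r+1}\subseteq\mathfrak{j}\subseteq\mathfrak{m}^2$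 (for $r\ge 1$). $\mathrm{Aut}\,A$ denotes the group of $\mathbb{R}$-algebra automorphisms of $A$, and $SA=\{a\in A;\ \phi(a)=a\text{ for all }\phi\in\mathrm{Aut}\,A\}$ is the subalgebra of fixed points of $A$. It always contains the constants $\mathbb{R}=\mathbb{R}\cdot 1$; it is called trivial if $SA=\mathbb{R}$. *)

(* Defs.v *)
From HB Require Import structures.
From mathcomp Require Import all_boot all_order all_algebra.
From mathcomp Require Import mpoly.
Set Implicit Arguments.
Unset Strict Implicit.
Unset Printing Implicit Defensive.
Import GRing.Theory.
Local Open Scope ring_scope.
Local Open Scope quotient_scope.

(* Ideals and subspaces are Prop-valued predicates, except for the ideal by   *)
(* which we divide, which has to be an [idealr] (a boolean, proper ideal).    *)

Section Ideals.
Variable B : comNzRingType.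
Implicit Types (I J S : B -> Prop).

Definition is_ideal I : Prop :=
  [/\ I 0, forall x y, I x -> I y -> I (x + y) & forall b x, I x -> I (b * x)].

Definition ideal_gen S (x : B) : Prop :=
  exists n (b s : 'I_n -> B), (forall l, S (s l)) /\ x = \sum_l b l * s l.

Definition ideal_add I J (x : B) : Prop :=
  exists y z, [/\ I y, J z & x = y + z].

Definition ideal_mul I J : B -> Prop :=
  ideal_gen (fun x => exists y z, [/\ I y, J z & x = y * z]).

(* The zeroth power is the unit ideal. *)
Fixpoint ideal_exp I (n : nat) : B -> Prop :=
  if n is n'.+1 then ideal_mul I (ideal_exp I n') else fun=> True.

Definition maximal_ideal M : Prop :=
  [/\ is_ideal M, ~ M 1
    & forall I, is_ideal I -> ~ I 1 -> (forall x, M x -> I x) ->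
      forall x, I x -> M x].

Definition is_local : Prop :=
  exists2 M, maximal_ideal M
    & forall M', maximal_ideal M' -> forall x, M' x <-> M x.

Definition nilradical (x : B) : Prop := exists n, x ^+ n = 0.

End Ideals.

(* dim (V / W) = d, for subspaces W <= V: some d vectors of V represent a     *)
(* basis of the quotient.                                                     *)
Definition quot_dim (F : fieldType) (E : lmodType F) (V W : E -> Prop)
    (d : nat) : Prop :=
  exists2 e : 'I_d -> E, forall l, V (e l)
    & forall v, V v ->
        exists! c : {ffun 'I_d -> F}, W (v - \sum_l c l *: e l).

Section WeilAlgebras.
Variables (F : fieldType) (A : comAlgType F).

(* The last component says that F -> A -> A / n_A is bijective. *)
Definition is_weil_algebra : Prop :=
  [/\ is_local A,
      exists d, quot_dim (@nilradical A) (fun x => x = 0) d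
    & forall a : A, exists! c : F, nilradical (a - c%:A)].

Definition has_width (k : nat) : Prop :=
  quot_dim (@nilradical A) (ideal_exp (@nilradical A) 2) k.

(* r >= 0 is no restriction: the zeroth power of n_A is A, which is nonzero. *)
Definition has_order (r : nat) : Prop :=
  let vanishes s := forall x, ideal_exp (@nilradical A) s.+1 x -> x = 0 in
  vanishes r /\ forall s, vanishes s -> (r <= s)%N.

Definition fixed_subalgebra (a : A) : Prop :=
  forall phi : {lrmorphism A -> A}, bijective phi -> phi a = a.

End WeilAlgebras.

(* ring_quotient only makes {ideal_quot I} a ring; we add the algebra         *)
(* structure for which the canonical projection is F-linear.                  *)
Section QuotientAlgebra.
Variables (F : comNzRingType) (S : comAlgType F) (I : idealr S).
Local Notation Q := {ideal_quot I}.

Definition quot_scale (c : F) (x : Q) : Q := \pi_Q (c%:A) * x.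

Fact quot_scaleA a b x : quot_scale a (quot_scale b x) = quot_scale (a * b) x.
Proof. by rewrite /quot_scale mulrA -rmorphM -scalerAl mul1r scalerA. Qed.

Fact quot_scale1 : left_id 1 quot_scale.
Proof. by move=> x; rewrite /quot_scale scale1r rmorph1 mul1r. Qed.

Fact quot_scaleDr : right_distributive quot_scale +%R.
Proof. by move=> a x y; rewrite /quot_scale mulrDr. Qed.

Fact quot_scaleDl x : {morph quot_scale^~ x : a b / a + b}.
Proof. by move=> a b; rewrite /quot_scale scalerDl rmorphD mulrDl. Qed.

HB.instance Definition _ := GRing.Zmodule_isLmodule.Build F Q
  quot_scaleA quot_scale1 quot_scaleDr quot_scaleDl.

Fact quot_scaleAl (a : F) (x y : Q) : a *: (x * y) = (a *: x) * y.
Proof. exact: mulrA. Qed.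

HB.instance Definition _ := GRing.Lmodule_isLalgebra.Build F Q quot_scaleAl.

Fact quot_scaleAr (a : F) (x y : Q) : a *: (x * y) = x * (a *: y).
Proof. exact: mulrCA. Qed.

HB.instance Definition _ := GRing.Lalgebra_isAlgebra.Build F Q quot_scaleAr.

Lemma pi_scale (c : F) (s : S) : \pi_Q (c *: s) = c *: \pi_Q s.
Proof. by rewrite -[in LHS](mul1r s) scalerAl rmorphM. Qed.

End QuotientAlgebra.

Section Presentations.
Variables (F : fieldType) (k : nat).

Definition mvars : {mpoly F[k]} -> Prop :=
  ideal_gen (fun p => exists l, p = 'X_l).

(* j = i + m^(r+1) for some ideal i contained in m^2, where m = mvars. *)
Definition weil_ideal (r : nat) (j : idealr {mpoly F[k]}) : Prop :=
  exists i : {mpoly F[k]} -> Prop,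
    [/\ is_ideal i, forall p, i p -> ideal_exp mvars 2 p
      & forall p, p \in j <-> ideal_add i (ideal_exp mvars r.+1) p].

(* The algebra endomorphism 'X_l |-> tau l *: 'X_l. *)
Definition scale_vars (tau : 'I_k -> F) (p : {mpoly F[k]}) : {mpoly F[k]} :=
  p \mPo [tuple tau l *: 'X_l | l < k].

End Presentations.

(* Main.v *)
Require Import Defs.
From HB Require Import structures.
From mathcomp Require Import all_boot all_order all_algebra.
From mathcomp Require Import reals.
From mathcomp Require Import mpoly.
Import Order.TTheory GRing.Theory Num.Theory.
Local Open Scope ring_scope.
Local Open Scope quotient_scope.

(** The scaling H of the variables descends to an algebra endomorphism of the
    quotient A, under which the class of each monomial x^m is an eigenvector
    with eigenvalue tau^m, that is [mmap1 tau m]. The assumption on tau enters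
    only through two consequences: tau^m is never 0 ([mmap1_neq0]), and
    tau^m = 1 only for m = 0 ([mmap1_neq1]).

    A is spanned by these eigenvectors, and eigenspaces for distinct
    eigenvalues are independent ([eigen_sum_eq0]). Applied to the eigenvalue 0
    this shows that the endomorphism is injective; it is onto because the
    class of x^m is the image of its own multiple by 1 / tau^m, so it is an
    automorphism of A ([quot_scale_vars_bij]). Applied to the eigenvalue 1 it
    shows that an element of A which is fixed by this single automorphism, and
    which is represented by a polynomial without constant term, vanishes
    ([pi_eigen_eq0]). Subtracting the constant term of a representative, every
    fixed element is a constant. *)

(** Applying f - lam i kills the i-th term and multiplies v by the nonzero
    scalar c - lam i, which leaves a shorter sum of the same kind. *)
Lemma eigen_sum_eq0 (F : fieldType) (V : lmodType F) (f : {linear V -> V})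
    (I : eqType) (s : seq I) (w : I -> V) (lam : I -> F) (c : F) (v : V) :
    {in s, forall i, f (w i) = lam i *: w i} ->
    {in s, forall i, lam i != c} ->
  f v = c *: v -> v = \sum_(i <- s) w i -> v = 0.
Proof.
elim: s w v => [|i s IHs] w v fw lamNc fv; first by rewrite big_nil.
move=> vE.
have lamiNc : c - lam i != 0.
  by rewrite subr_eq0 eq_sym lamNc // mem_head.
suff /eqP: (c - lam i) *: v = 0 by rewrite scaler_eq0 (negPf lamiNc) => /eqP.
apply: (IHs (fun j => (lam j - lam i) *: w j)) => [j js|j js||].
- by rewrite linearZ /= fw ?inE ?js ?orbT // !scalerA mulrC.
- by rewrite lamNc // inE js orbT.
- by rewrite linearZ /= fv !scalerA mulrC.
rewrite scalerBl -fv {1}vE linear_sum /= vE scaler_sumr -sumrB big_cons.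
rewrite fw ?mem_head // subrr add0r; apply: eq_big_seq => j js.
by rewrite fw ?inE ?js ?orbT // scalerBl.
Qed.

Lemma mmap1_neq0 (F : fieldType) (k : nat) (tau : 'I_k -> F) (m : 'X_{1..k}) :
  (forall l, tau l != 0) -> mmap1 tau m != 0.
Proof. by move=> tau0; apply/prodf_neq0 => l _; apply: expf_neq0. Qed.

Section Eigenvalues.
Variables (R : realFieldType) (k : nat).
Implicit Types (tau : 'I_k -> R) (m : 'X_{1..k}).

Lemma mmap1_gt1 tau m :
  (forall l, 1 < `|tau l|) -> m != 0%MM -> 1 < `|mmap1 tau m|.
Proof.
move=> tau1 m0.
have [l ml] : exists l, m l != 0%N.
  apply/existsP; apply: contraNT m0; rewrite negb_exists => /forallP mE.
  by apply/eqP/mnmP => l; rewrite mnm0E; apply/eqP; move: (mE l); rewrite negbK.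
rewrite /mmap1 normr_prod (bigD1 l) //= normrX.
apply: (@lt_le_trans _ _ (`|tau l| ^+ m l)); first by rewrite exprn_egt1.
rewrite ler_peMr ?exprn_ge0 //.
elim/big_ind: _ => // [x y|i _]; first exact: mulr_ege1.
by rewrite normrX exprn_ege1 // ltW.
Qed.

(** The two cases are exchanged by inverting every tau l. *)
Lemma mmap1_neq1 tau m :
    (forall l, tau l \notin `[-1, 1]) \/
    (forall l, (tau l \in `]-1, 1[) /\ tau l <> 0) ->
  m != 0%MM -> mmap1 tau m != 1.
Proof.
move=> [tau_gt1|tau_lt1] m0.
  have : 1 < `|mmap1 tau m|.
    apply: mmap1_gt1 m0 => l; move: (tau_gt1 l).
    by rewrite in_itv /= -ler_norml -ltNge.
  by apply: contraTneq => ->; rewrite normr1 ltxx.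
have : 1 < `|mmap1 (fun l => (tau l)^-1) m|.
  apply: mmap1_gt1 m0 => l; have [] := tau_lt1 l.
  rewrite in_itv /= -ltr_norml normfV => tau1 /eqP tau0.
  by rewrite invf_gt1 // normr_gt0.
apply: contraTneq => tau1; rewrite /mmap1.
under eq_bigr do rewrite exprVn.
by rewrite prodfV -/(mmap1 tau m) tau1 invr1 normr1 ltxx.
Qed.

Lemma scale_factor_neq0 tau l :
    (forall l, tau l \notin `[-1, 1]) \/
    (forall l, (tau l \in `]-1, 1[) /\ tau l <> 0) ->
  tau l != 0.
Proof.
move=> [/(_ l)|/(_ l)[_ /eqP//]].
by apply: contraNneq => ->; rewrite in_itv /= oppr_le0 ler01.
Qed.

End Eigenvalues.

Section QuotientEndomorphism.
Variables (F : comNzRingType) (S : comAlgType F) (I : idealr S).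
Variable h : {lrmorphism S -> S}.
Hypothesis hI : forall p, p \in I -> h p \in I.
Local Notation Q := {ideal_quot I}.

(** The proof of stability of I is an argument, so that the morphism structures
    below can be inferred from the function alone. *)
Definition quot_endo of (forall p, p \in I -> h p \in I) : Q -> Q :=
  fun a => \pi_Q (h (repr a)).

Local Notation hQ := (quot_endo hI).

Lemma quot_endo_pi p : hQ (\pi_Q p) = \pi_Q (h p).
Proof.
apply/eqP; rewrite -Quotient.idealrBE -rmorphB hI //.
by rewrite Quotient.idealrBE reprK.
Qed.

Fact quot_endo_zmod_morphism : zmod_morphism hQ.
Proof.
elim/quotW=> p; elim/quotW=> q.
by rewrite -rmorphB !quot_endo_pi !rmorphB.
Qed.

Fact quot_endo_monoid_morphism : monoid_morphism hQ.
Proof.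
split; first by have := quot_endo_pi 1; rewrite !rmorph1.
elim/quotW=> p; elim/quotW=> q.
by rewrite -rmorphM !quot_endo_pi !rmorphM.
Qed.

Fact quot_endo_scalable : scalable hQ.
Proof.
move=> c; elim/quotW=> p.
by rewrite -pi_scale !quot_endo_pi linearZ /= pi_scale.
Qed.

HB.instance Definition _ :=
  GRing.isZmodMorphism.Build Q Q hQ quot_endo_zmod_morphism.
HB.instance Definition _ :=
  GRing.isMonoidMorphism.Build Q Q hQ quot_endo_monoid_morphism.
HB.instance Definition _ :=
  GRing.isScalable.Build F Q Q *:%R hQ quot_endo_scalable.

End QuotientEndomorphism.
Arguments quot_endo {F S I h} hI a.

Section ScaleVars.
Variables (F : fieldType) (k : nat) (j : idealr {mpoly F[k]}).
Variable tau : 'I_k -> F.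
Local Notation Q := {ideal_quot j}.

HB.instance Definition _ := GRing.LRMorphism.copy (@scale_vars F k tau)
  (comp_mpoly [tuple tau l *: 'X_l | l < k]).

Lemma scale_varsX m : scale_vars tau 'X_[m] = mmap1 tau m *: 'X_[m].
Proof.
rewrite /scale_vars comp_mpolyX [X in _ *: X]mpolyXE_id.
under eq_bigr do rewrite tnth_mktuple exprZn.
by rewrite scaler_prod.
Qed.

Hypothesis tau_j : forall p, p \in j -> scale_vars tau p \in j.
Local Notation H := (quot_endo tau_j).

Lemma quot_scale_varsX m :
  H (\pi_Q 'X_[m]) = mmap1 tau m *: \pi_Q 'X_[m].
Proof. by rewrite quot_endo_pi /= scale_varsX pi_scale. Qed.

(** The class of p is a sum of eigenvectors, one for each monomial of p. *)
Lemma pi_eigen_eq0 (c : F) (p : {mpoly F[k]}) :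
    {in msupp p, forall m, mmap1 tau m != c} ->
  H (\pi_Q p) = c *: \pi_Q p -> \pi_Q p = 0.
Proof.
move=> tauNc Hp.
apply: (@eigen_sum_eq0 _ _ H _ (msupp p) (fun m => p@_m *: \pi_Q 'X_[m])
          (mmap1 tau)) tauNc Hp _ => [m _|].
  by rewrite linearZ /= quot_scale_varsX !scalerA mulrC.
rewrite {1}(mpolyE p) raddf_sum /=.
by apply: eq_bigr => m _; rewrite pi_scale.
Qed.

Lemma quot_scale_vars_bij : (forall l, tau l != 0) -> bijective H.
Proof.
move=> tau0.
have H_inj : injective H.
  apply: raddf_inj; elim/quotW=> p Hp0.
  apply: (@pi_eigen_eq0 0) => [m _|]; first exact: mmap1_neq0.
  by rewrite scale0r.
pose g p := \sum_(m <- msupp p) (p@_m / mmap1 tau m) *: 'X_[m].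
have gK p : scale_vars tau (g p) = p.
  rewrite linear_sum /= [RHS]mpolyE; apply: eq_bigr => m _.
  by rewrite linearZ /= scale_varsX scalerA divfK // mmap1_neq0.
pose G (a : Q) := \pi_Q (g (repr a)).
have GK : cancel G H by move=> a; rewrite quot_endo_pi /= gK reprK.
by exists G => //; apply: inj_can_sym GK H_inj.
Qed.

End ScaleVars.

Theorem proposition3 (R : realType) (k r : nat) (j : idealr {mpoly R[k]})
    (weilA : is_weil_algebra {ideal_quot j})
    (widthA : has_width {ideal_quot j} k)
    (orderA : has_order {ideal_quot j} r)
    (presA : weil_ideal r j)
    (htau : exists tau : 'I_k -> R,
       ((forall l, tau l \notin `[-1, 1]) \/
        (forall l, (tau l \in `]-1, 1[) /\ tau l <> 0)) /\
       (forall p, p \in j -> scale_vars tau p \in j)) :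
  forall a : {ideal_quot j}, fixed_subalgebra a <-> exists c : R, a = c%:A.
Proof.
move=> a; split=> [a_fix|[c ->] phi _]; last by rewrite linearZ /= rmorph1.
have [tau [tauP tau_j]] := htau.
have H_bij : bijective (quot_endo tau_j).
  by apply: quot_scale_vars_bij => l; apply: scale_factor_neq0.
have := a_fix (quot_endo tau_j) H_bij.
elim/quotW: a {a_fix} => p Hp; set c := p@_0%MM; exists c.
apply/eqP; rewrite -subr_eq0; apply/eqP.
have qE : \pi_{ideal_quot j} p - c%:A = \pi_{ideal_quot j} (p - c%:MP).
  by rewrite rmorphB /= -alg_mpolyC pi_scale rmorph1.
rewrite qE; apply: (@pi_eigen_eq0 _ _ _ tau tau_j 1) => [m|].
  move=> m_supp; apply: mmap1_neq1 => //; apply: contraTneq m_supp => ->.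
  by rewrite mcoeff_msupp mcoeffB mcoeffC eqxx mulr1 subrr eqxx.
by rewrite -qE scale1r linearB linearZ /= rmorph1; congr (_ - _).
Qed.
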